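(* Let $\mathcal R\subseteq P$ be a set of partitions that is closed under rotation. Then the following are equivalent: (1) $\mathcal R$ is a skew category of partitions. (2) $F_\infty(\mathcal R):=\mathrm S_\infty(\{a_{\mathrm{ind}(p)}\mid k\in\mathbb N_0,\ p\in\mathcal R(k,0)\})$ is an ($\mathrm S_\infty$-invariant) normal subgroup of $\mathbb Z_2^{*\infty}$, and $\mathcal R=\{p\mid p\text{ is a rotation of }\ker(\mathbf i)\text{ for some } k\in\mathbb N_0,\ \mathbf i\in\mathbb N^k \text{ with } a_{\mathbf i}\in F_\infty(\mathcal R)\}$. (3) For every $n\in\mathbb N$ the collection of vector spaces $\mathrm{span}\{\widehat T^{(n)}_p\mid p\in\mathcal R(k,l)\}$, $k,l\in\mathbb N_0$, is a tensor category with duals.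
   Context: Partitions. $\mathbb N=\{1,2,\dots\}$, $\mathbb N_0=\mathbb N\cup\{0\}$. For $k,l\in\mathbb N_0$, $P(k,l)$ is the set of all set partitions of $\{1,\dots,k,1',\dots,l'\}$ (with $k$ upper points $1,\dots,k$ and $l$ lower points $1',\dots,l'$), and $P=\bigcup_{k,l}P(k,l)$. For $D\subseteq P$ put $D(k,l)=D\cap P(k,l)$. For $\mathbf i\in\mathbb N^k,\mathbf j\in\mathbb N^l$, $\ker(\mathbf i,\mathbf j)\in P(k,l)$ is the partition in which two points lie in the same block iff they carry the same label, where upper point $x$ carries $i_x$ and lower point $y'$ carries $j_y$; $\ker(\mathbf i):=\ker(\mathbf i,\emptyset)\in P(k,0)$. For $p\in P(k,l)$, $\mathrm{ind}(p)=(\mathbf i^{(p)},\mathbf j^{(p)})\in\mathbb N^k\times\mathbb N^l$ is the lexicographically minimal pair with $\ker(\mathrm{ind}(p))=p$. $\mathrm S_\infty$ is the group of bijections $\mathbb N\to\mathbb N$ moving only finitely many points; it acts componentwise on multi-indices, and $\mathrm S_\infty(x)$ denotes the orbit of $x$ (for a set $X$, $\mathrm S_\infty(X)$ is the union of the orbits of its elements). Thus $(\mathbf i,\mathbf j)\in \mathrm S_\infty(\mathrm{ind}(p))$ iff $\ker(\mathbf i,\mathbf j)=p$. Juxtaposition $\mathbf{if}$ of multi-indices is concatenation. Rotation. A basic rotation of $p$ moves the leftmost upper point to the left end of the lower row, or the leftmost lower point to the left end of the upper row, or the rightmost upper point to the right end of the lower row, or the rightmost lower point to the right end of the upper row, keeping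 block membership. A rotation of $p$ is the result of a finite (possibly empty) sequence of basic rotations. Operations. Let $p\in P(k,l)$, $q\in P(k',l')$. The involution $p^*\in P(l,k)$ is $p$ turned upside-down, i.e. $\ker(\mathbf i,\mathbf j)^*=\ker(\mathbf j,\mathbf i)$. A connected tensor product of $p$ and $q$ is any $p\otimes_{(\mathbf{if},\mathbf{jg})}q:=\ker(\mathbf{if},\mathbf{jg})\in P(k+k',l+l')$ with $(\mathbf i,\mathbf j)\in \mathrm S_\infty(\mathrm{ind}(p))$, $(\mathbf f,\mathbf g)\in \mathrm S_\infty(\mathrm{ind}(q))$. If $l=k'$, $p$ and $q$ are compatible if $\mathbf j^{(p)}\in \mathrm S_\infty(\mathbf i^{(q)})$. In this case the conditioned composition of $p$ and $q$ is the usual composition $qp\in P(k,l')$: place $p$ above $q$, identify the lower points of $p$ with the upper points of $q$, merge blocks accordingly, and restrict to the upper points of $p$ and lower points of $q$ (components consisting only of middle points are removed). A skew category of partitions is a subset of $P$ containing $\sqcup:=\ker((1,1),\emptyset)\in P(2,0)$ and $|:=\ker((1),(1))\in P(1,1)$ and closed under involution, (all) connected tensor products and conditioned composition of compatible partitions. Free product. $\mathbb Z_2^{*\infty}=\langle a_i\ (i\in\mathbb N)\mid a_i^2=1\rangle$; for $\mathbf i=(i_1,\dots,i_k)\in\mathbb N^k$, $a_{\mathbf i}=a_{i_1}\cdots a_{i_k}$ (for $k=0$ the neutral element). For $p\in P(k,0)$, $\mathrm{ind}(p)$ is regarded as an element of $\mathbb N^k$. $\mathrm S_\infty$ acts on $\mathbb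 Z_2^{*\infty}$ by $\sigma(a_{\mathbf i})=a_{\sigma(\mathbf i)}$. Linear maps. For $n\in\mathbb N$, $\underline n=\{1,\dots,n\}$, $e_1,\dots,e_n$ the standard basis of $\mathbb C^n$, and $p\in P(k,l)$, $\widehat T^{(n)}_p:(\mathbb C^n)^{\otimes k}\to(\mathbb C^n)^{\otimes l}$ is the linear map with $\widehat T^{(n)}_p(e_{i_1}\otimes\cdots\otimes e_{i_k})=\sum_{\mathbf j\in\underline n^l}\widehat\delta_p(\mathbf i,\mathbf j)\,e_{j_1}\otimes\cdots\otimes e_{j_l}$, where $\widehat\delta_p(\mathbf i,\mathbf j)=1$ if $(\mathbf i,\mathbf j)\in \mathrm S_\infty(\mathrm{ind}(p))$ and $0$ otherwise. Tensor category with duals (for fixed $n$): a collection of vector spaces $\mathcal H(k,l)\subseteq\mathrm{Hom}((\mathbb C^n)^{\otimes k},(\mathbb C^n)^{\otimes l})$, $k,l\in\mathbb N_0$, such that it is closed under tensor products ($T\in\mathcal H(k,l),T'\in\mathcal H(k',l')\Rightarrow T\otimes T'\in\mathcal H(k+k',l+l')$), composition ($T\in\mathcal H(k,l),T'\in\mathcal H(l,l')\Rightarrow T'T\in\mathcal H(k,l')$) and adjoints ($T\in\mathcal H(k,l)\Rightarrow T^*\in\mathcal H(l,k)$), with $\mathrm{id}_{\mathbb C^n}\in\mathcal H(1,1)$ and with the map $\zeta:\mathbb C\to(\mathbb C^n)^{\otimes2}$, $1\mapsto\sum_{i=1}^n e_i\otimes e_i$, in $\mathcal H(0,2)$. *)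

(* Defs.v *)
From HB Require Import structures.
From mathcomp Require Import all_boot all_order all_algebra.
From mathcomp Require Import complex.
From mathcomp Require Import boolp reals.

Set Implicit Arguments.
Unset Strict Implicit.
Unset Printing Implicit Defensive.

Import GRing.Theory Num.Theory.

(* Conventions.  The label set N = {1, 2, ...} is encoded by nat, the label i
   being represented by i.-1; likewise {1, ..., n} is encoded by 'I_n, and
   nat_of_ord is the inclusion of {1, ..., n} in N.  The k upper points and
   the l lower points of a partition are the elements inl x (x : 'I_k) and
   inr y (y : 'I_l) of 'I_k + 'I_l, numbered from the left. *)

Definition part (k l : nat) :=
  {p : {set {set 'I_k + 'I_l}} | partition p [set: 'I_k + 'I_l]}.

HB.instance Definition _ k l := SubFinite.on (part k l).

Definition partitions_set := forall k l : nat, part k l -> Prop.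

Definition same_block k l (p : part k l) : rel ('I_k + 'I_l) :=
  fun x y => y \in pblock (val p) x.

Definition label (T : Type) k l (i : k.-tuple T) (j : l.-tuple T)
    (x : 'I_k + 'I_l) : T :=
  match x with inl a => tnth i a | inr b => tnth j b end.

Definition ker k l (i : k.-tuple nat) (j : l.-tuple nat) : part k l :=
  exist _ (preim_partition (label i j) setT) (preim_partitionP _ _).

(* The partition of the points of P(k', l') in which x and y lie in the same
   block iff h x and h y do in p. *)
Definition pullback k l k' l' (h : 'I_k' + 'I_l' -> 'I_k + 'I_l)
    (p : part k l) : part k' l' :=
  exist _ (preim_partition (fun x => pblock (val p) (h x)) setT)
    (preim_partitionP _ _).

Lemma same_block_equiv k l (p : part k l) :
  {in [set: 'I_k + 'I_l] & &, equivalence_rel (same_block p)}.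
Proof.
have /and3P [/eqP cov triv _] := valP p.
have memT z : z \in cover (val p) by rewrite cov inE.
move=> x y z _ _ _; split=> [|xy]; first by rewrite /same_block mem_pblock.
by rewrite /same_block (same_pblock triv xy).
Qed.

Lemma same_block_ker k l (i : k.-tuple nat) (j : l.-tuple nat) x y :
  same_block (ker i j) x y = (label i j x == label i j y).
Proof.
rewrite /same_block /ker /= /preim_partition pblock_equivalence_partition //.
by split=> // /eqP ->.
Qed.

Lemma same_block_pullback k l k' l' (h : 'I_k' + 'I_l' -> 'I_k + 'I_l)
    (p : part k l) x y :
  same_block (pullback h p) x y = same_block p (h x) (h y).
Proof.
have /and3P [/eqP cov triv _] := valP p.
rewrite /same_block /pullback /= /preim_partition.
rewrite pblock_equivalence_partition //; last by split=> // /eqP ->.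
by rewrite eq_pblock // cov inE.
Qed.

Lemma part_ext k l (p q : part k l) :
  same_block p =2 same_block q -> p = q.
Proof.
move=> pq; apply: val_inj.
have pE (r : part k l) : val r = equivalence_partition (same_block r) setT.
  have /and3P [/eqP cov triv n0] := valP r.
  have rT : val r = [set pblock (val r) x | x in setT].
    apply/setP=> B; apply/idP/imsetP => [Br|[x _ ->]].
      have [x xB] : exists x, x \in B.
        by apply/set0Pn; apply: contraNneq n0 => <-.
      by exists x; rewrite ?inE // (def_pblock triv Br xB).
    by apply: pblock_mem; rewrite cov inE.
  rewrite [LHS]rT /equivalence_partition; apply: eq_imset => x.
  by apply/setP=> y; rewrite !inE.
rewrite pE [RHS]pE /equivalence_partition; apply: eq_imset => x.
by apply/setP=> y; rewrite !inE pq.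
Qed.

Definition finitary_perm (s : nat -> nat) : Prop :=
  bijective s /\ exists m, forall i, m <= i -> s i = i.

Definition same_orbit k l (i : k.-tuple nat) (j : l.-tuple nat)
    (i' : k.-tuple nat) (j' : l.-tuple nat) : Prop :=
  exists2 s, finitary_perm s &
    i = [tuple of map s i'] /\ j = [tuple of map s j'].

Definition is_ind k l (p : part k l)
    (ij : k.-tuple nat * l.-tuple nat) : Prop :=
  ker ij.1 ij.2 = p /\
  forall i j, ker i j = p ->
    ((ij.1 ++ ij.2 : seqlexi nat) <= (i ++ j : seqlexi nat))%O.

Lemma lexi_min n (P : seq nat -> Prop) :
  (forall w, P w -> size w = n) -> (exists w, P w) ->
  exists2 w, P w & forall v, P v -> ((w : seqlexi nat) <= (v : seqlexi nat))%O.
Proof.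
elim: n P => [|n IHn] P szP [w Pw].
  exists w => // v /szP /size0nil ->.
  by move/szP/size0nil: Pw => ->.
pose Q a := `[< exists u, P (a :: u) >].
have exQ : exists a, Q a.
  case: w Pw (szP _ Pw) => // a u Pau _.
  by exists a; apply/asboolP; exists u.
case: (ex_minnP exQ) => a /asboolP exa amin.
have [|u Pu umin] := IHn (fun u => P (a :: u)) _ exa.
  by move=> u /szP [].
exists (a :: u) => // -[|b v] Pv; first by have := szP _ Pv.
have ab : a <= b by apply: amin; apply/asboolP; exists v.
rewrite Order.SeqLexiOrder.lexi_cons !leEnat ab /=; apply/implyP => ba.
have eab : a = b by apply/eqP; rewrite eqn_leq ab ba.
by apply: umin; rewrite eab.
Qed.

Lemma ind_exists k l (p : part k l) : exists ij, is_ind p ij.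
Proof.
have [||w [i [j [wE ijp]]] wmin] :=
  @lexi_min (k + l) (fun w => exists i j, w = val i ++ val j /\ @ker k l i j = p).
- by move=> w [i [j [-> _]]]; rewrite size_cat !size_tuple.
- pose f x : nat := enum_rank (pblock (val p) x).
  pose i := [tuple f (inl a) | a < k]; pose j := [tuple f (inr b) | b < l].
  exists (i ++ j), i, j; split=> //; apply: part_ext => x y.
  have fE z : label i j z = f z by case: z => z; rewrite /label tnth_mktuple.
  have /and3P [/eqP cov triv _] := valP p.
  rewrite same_block_ker !fE /f.
  rewrite -[LHS]/(enum_rank _ == enum_rank _ :> 'I__) (inj_eq enum_rank_inj).
  by rewrite eq_pblock // cov inE.
exists (i, j); split=> //= i' j' h; rewrite -wE; apply: wmin.
by exists i', j'.
Qed.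

Definition ind k l (p : part k l) : k.-tuple nat * l.-tuple nat :=
  sval (cid (ind_exists p)).

Lemma indP k l (p : part k l) : is_ind p (ind p).
Proof. by rewrite /ind; case: cid. Qed.

Lemma is_ind_uniq k l (p : part k l) ij : is_ind p ij -> ij = ind p.
Proof.
case: (indP p) => pk pmin [hk hmin].
have /eqP := Order.POrderTheory.le_anti
  (introT andP (conj (hmin _ _ pk) (pmin _ _ hk))).
rewrite eqseq_cat ?size_tuple // => /andP [/eqP h1 /eqP h2].
by rewrite [ij]surjective_pairing [RHS]surjective_pairing;
  congr pair; apply: val_inj.
Qed.

Definition in_orbit_ind k l (p : part k l)
    (i : k.-tuple nat) (j : l.-tuple nat) : Prop :=
  same_orbit i j (ind p).1 (ind p).2.

(* If the upper point at position a moves to the position b of the lower row,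
   then lower_pt a b sends a point of the new partition to the point of the old
   one that it comes from; raise_pt does the same for a lower point at position
   b that moves to the position a of the upper row. *)
Definition lower_pt k l (a : 'I_k.+1) (b : 'I_l.+1)
    (x : 'I_k + 'I_l.+1) : 'I_k.+1 + 'I_l :=
  match x with
  | inl i => inl (lift a i)
  | inr j => if unlift b j is Some j' then inr j' else inl a
  end.

Definition raise_pt k l (a : 'I_k.+1) (b : 'I_l.+1)
    (x : 'I_k.+1 + 'I_l) : 'I_k + 'I_l.+1 :=
  match x with
  | inl i => if unlift a i is Some i' then inl i' else inr b
  | inr j => inr (lift b j)
  end.

Inductive basic_rotation :
    forall k l, part k l -> forall k' l', part k' l' -> Prop :=
| rot_lower_left k l (p : part k.+1 l) :
    basic_rotation p (pullback (@lower_pt k l ord0 ord0) p)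
| rot_raise_left k l (p : part k l.+1) :
    basic_rotation p (pullback (@raise_pt k l ord0 ord0) p)
| rot_lower_right k l (p : part k.+1 l) :
    basic_rotation p (pullback (@lower_pt k l ord_max ord_max) p)
| rot_raise_right k l (p : part k l.+1) :
    basic_rotation p (pullback (@raise_pt k l ord_max ord_max) p).

Inductive rotation k l (p : part k l) :
    forall k' l', part k' l' -> Prop :=
| rotation_refl : rotation p p
| rotation_step k1 l1 (q : part k1 l1) k2 l2 (r : part k2 l2) :
    rotation p q -> basic_rotation q r -> rotation p r.

Definition rotation_closed (D : partitions_set) : Prop :=
  forall k l (p : part k l) k' l' (q : part k' l'),
    D k l p -> rotation p q -> D k' l' q.

Definition swap_pt k l (x : 'I_l + 'I_k) : 'I_k + 'I_l :=
  match x with inl y => inr y | inr y => inl y end.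

Definition involution k l (p : part k l) : part l k :=
  pullback (@swap_pt k l) p.

Lemma involution_ker k l (i : k.-tuple nat) (j : l.-tuple nat) :
  involution (ker i j) = ker j i.
Proof.
apply: part_ext => x y; rewrite same_block_pullback !same_block_ker.
by case: x; case: y.
Qed.

Definition connected_tensor k l (p : part k l) k' l' (q : part k' l')
    (r : part (k + k') (l + l')) : Prop :=
  exists i j f g, [/\ in_orbit_ind p i j, in_orbit_ind q f g &
    r = ker [tuple of i ++ f] [tuple of j ++ g]].

Definition compatible k l m (p : part k l) (q : part l m) : Prop :=
  exists2 s, finitary_perm s & (ind p).2 = [tuple of map s (ind q).1].

(* In the diagram with p above q, the three rows of points are indexed by
   ('I_k + 'I_l) + 'I_m: the points of p are embedded by inl, those of q by
   stack_low, and the points of the upper and the lower row by stack_outer. *)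
Definition stack_low k l m (x : 'I_l + 'I_m) : ('I_k + 'I_l) + 'I_m :=
  match x with inl y => inl (inr y) | inr z => inr z end.

Definition stack_outer k l m (x : 'I_k + 'I_m) : ('I_k + 'I_l) + 'I_m :=
  match x with inl y => inl (inl y) | inr z => inr z end.

Definition stack k l m (p : part k l) (q : part l m) :
    rel (('I_k + 'I_l) + 'I_m) :=
  fun x y =>
    [exists u, exists v, [&& x == inl u, y == inl v & same_block p u v]]
    || [exists u, exists v,
          [&& x == stack_low k u, y == stack_low k v & same_block q u v]].

Definition connected_in_stack k l m (p : part k l) (q : part l m) :
    rel ('I_k + 'I_m) :=
  fun x y => connect (stack p q) (stack_outer l x) (stack_outer l y).

Lemma same_block_sym k l (p : part k l) : symmetric (same_block p).
Proof.
suff h x y : same_block p x y -> same_block p y x.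
  by move=> x y; apply/idP/idP; exact: h.
move=> xy.
have [xx] := same_block_equiv p (in_setT x) (in_setT y) (in_setT x).
by move=> /(_ xy) <-.
Qed.

Lemma stack_sym k l m (p : part k l) (q : part l m) : symmetric (stack p q).
Proof.
suff h x y : stack p q x y -> stack p q y x by move=> x y; apply/idP/idP; exact: h.
by case/orP=> /existsP [u /existsP [v /and3P [xu yv uv]]];
  apply/orP; [left|right]; apply/existsP; exists v; apply/existsP; exists u;
  rewrite xu yv same_block_sym.
Qed.

Lemma connected_in_stack_equiv k l m (p : part k l) (q : part l m) :
  {in [set: 'I_k + 'I_m] & &, equivalence_rel (connected_in_stack p q)}.
Proof.
have csym : connect_sym (stack p q) by apply: sym_connect_sym; exact: stack_sym.
move=> x y z _ _ _; split=> [|xy]; first exact: connect0.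
exact: (same_connect csym xy).
Qed.

(* The composition qp; conditioned composition is its restriction to compatible
   p and q. *)
Definition compose k l m (p : part k l) (q : part l m) : part k m :=
  exist _ (equivalence_partition (connected_in_stack p q) setT)
    (equivalence_partitionP (@connected_in_stack_equiv k l m p q)).

Lemma same_block_compose k l m (p : part k l) (q : part l m) x y :
  same_block (compose p q) x y = connected_in_stack p q x y.
Proof.
rewrite /same_block /compose /= pblock_equivalence_partition //.
exact: connected_in_stack_equiv.
Qed.

Definition skew_category (D : partitions_set) : Prop :=
  [/\ D 2 0 (ker [tuple 0; 0] [tuple]),
      D 1 1 (ker [tuple 0] [tuple 0]),
      forall k l (p : part k l), D k l p -> D l k (involution p),
      forall k l (p : part k l) k' l' (q : part k' l')
             (r : part (k + k') (l + l')),
        D k l p -> D k' l' q -> connected_tensor p q r ->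
        D (k + k') (l + l') r
    & forall k l m (p : part k l) (q : part l m),
        D k l p -> D l m q -> compatible p q -> D k m (compose p q)].

(* As the relations make every generator its own inverse, the group presented
   by the generators a_i and the relations a_i^2 = 1 is the monoid with the
   same presentation: the quotient of the free monoid of words by the
   congruence generated by the relations. *)
Inductive word_cong : seq nat -> seq nat -> Prop :=
| cong_rel i : word_cong [:: i; i] [::]
| cong_refl u : word_cong u u
| cong_sym u v : word_cong u v -> word_cong v u
| cong_trans u v w : word_cong u v -> word_cong v w -> word_cong u w
| cong_cat u u' v v' :
    word_cong u u' -> word_cong v v' -> word_cong (u ++ v) (u' ++ v').

Definition word_eq : rel (seq nat) := fun u v => `[< word_cong u v >].

Lemma word_eq_refl : reflexive word_eq.
Proof. by move=> u; apply/asboolP; exact: cong_refl. Qed.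

Lemma word_eq_sym : symmetric word_eq.
Proof. by move=> u v; apply/asboolP/asboolP; exact: cong_sym. Qed.

Lemma word_eq_trans : transitive word_eq.
Proof.
move=> u v w /asboolP vu /asboolP uw; apply/asboolP; exact: cong_trans vu uw.
Qed.

Canonical word_eq_equiv :=
  EquivRel word_eq word_eq_refl word_eq_sym word_eq_trans.

Definition Z2free := {eq_quot word_eq}%qT.
HB.instance Definition _ := Choice.on Z2free.

Definition wcl (w : seq nat) : Z2free := (\pi_({eq_quot word_eq}%qT) w)%qT.

Definition wrepr (x : Z2free) : seq nat := repr (x : {eq_quot word_eq}%qT).

Lemma wreprK : cancel wrepr wcl.
Proof. by move=> x; rewrite /wcl /wrepr reprK. Qed.

Lemma wclP u v : wcl u = wcl v <-> word_cong u v.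
Proof.
by split=> [/eqmodP /asboolP //|h]; apply/eqmodP; apply/asboolP.
Qed.

Lemma wcl_reprP w : word_cong (wrepr (wcl w)) w.
Proof. by apply/wclP; rewrite wreprK. Qed.

Definition zmul (x y : Z2free) : Z2free := wcl (wrepr x ++ wrepr y).
Definition zone : Z2free := wcl [::].
Definition zinv (x : Z2free) : Z2free := wcl (rev (wrepr x)).

Lemma zmulE u v : zmul (wcl u) (wcl v) = wcl (u ++ v).
Proof. by apply/wclP; apply: cong_cat; exact: wcl_reprP. Qed.

Lemma cong_rev u v : word_cong u v -> word_cong (rev u) (rev v).
Proof.
elim=> [i|w|w w' _|w1 w2 w3 _ h1 _ h2|u1 u1' v1 v1' _ h1 _ h2].
- exact: cong_rel.
- exact: cong_refl.
- exact: cong_sym.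
- exact: cong_trans h1 h2.
- by rewrite !rev_cat; apply: cong_cat.
Qed.

Lemma zinvE u : zinv (wcl u) = wcl (rev u).
Proof. by apply/wclP; apply: cong_rev; exact: wcl_reprP. Qed.

Lemma cong_revl w : word_cong (rev w ++ w) [::].
Proof.
elim: w => [|i w IHw]; first exact: cong_refl.
rewrite rev_cons cat_rcons -[i :: i :: w]/([:: i; i] ++ w).
apply: cong_trans IHw; apply: cong_cat; first exact: cong_refl.
by rewrite -[w in X in word_cong _ X]cat0s;
  apply: cong_cat; [exact: cong_rel|exact: cong_refl].
Qed.

Lemma zmulA : associative zmul.
Proof.
move=> x y z; rewrite -(wreprK x) -(wreprK y) -(wreprK z).
by rewrite !zmulE catA.
Qed.

Lemma zmul1 : left_id zone zmul.
Proof. by move=> x; rewrite -(wreprK x) zmulE. Qed.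

Lemma zmulr1 : right_id zone zmul.
Proof. by move=> x; rewrite -(wreprK x) zmulE cats0. Qed.

Lemma zmulV : left_inverse zone zinv zmul.
Proof.
move=> x; rewrite -(wreprK x) zinvE zmulE; apply/wclP; exact: cong_revl.
Qed.

Lemma zmulrV : right_inverse zone zinv zmul.
Proof.
move=> x; rewrite -(wreprK x) zinvE zmulE; apply/wclP.
by rewrite -[X in X ++ _]revK; exact: cong_revl.
Qed.

HB.instance Definition _ :=
  isGroup.Build Z2free zmulA zmul1 zmulr1 zmulV zmulrV.

Definition gen (i : nat) : Z2free := wcl [:: i].

Definition aw (w : seq nat) : Z2free := (\prod_(i <- w) gen i)%g.

Lemma aw_wcl w : aw w = wcl w.
Proof.
rewrite /aw; elim: w => [|i w IHw]; first by rewrite big_nil.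
by rewrite big_cons IHw; exact: zmulE.
Qed.

Lemma Z2free_universal (G : groupType) (h : nat -> G) :
  (forall i, h i * h i = 1)%g ->
  exists2 f : Z2free -> G,
    (forall x y, f (x * y) = f x * f y)%g & forall i, f (gen i) = h i.
Proof.
move=> h2; pose f w := (\prod_(i <- w) h i)%g.
have fP u v : word_cong u v -> f u = f v.
  elim=> // [i|u1 v1 w1 _ -> _ -> //|u1 u2 v1 v2 _ e1 _ e2].
    by rewrite /f big_cons big_seq1 big_nil h2.
  by move: e1 e2; rewrite /f !big_cat /= => -> ->.
exists (fun x => f (wrepr x)) => [x y|i].
  rewrite -[(x * y)%g]/(wcl (wrepr x ++ wrepr y)).
  by rewrite (fP _ _ (wcl_reprP _)) /f big_cat.
by rewrite (fP _ _ (wcl_reprP _)) /f big_seq1.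
Qed.

Definition act (s : nat -> nat) (x : Z2free) : Z2free := aw (map s (wrepr x)).

Lemma cong_map s u v : word_cong u v -> word_cong (map s u) (map s v).
Proof.
elim=> [i|w|w w' _|w1 w2 w3 _ h1 _ h2|u1 u1' v1 v1' _ h1 _ h2] /=.
- exact: cong_rel.
- exact: cong_refl.
- exact: cong_sym.
- exact: cong_trans h1 h2.
- by rewrite !map_cat; apply: cong_cat.
Qed.

Lemma act_aw s w : act s (aw w) = aw (map s w).
Proof.
by rewrite /act !aw_wcl; apply/wclP/cong_map; exact: wcl_reprP.
Qed.

Definition F_infty (D : partitions_set) : Z2free -> Prop :=
  fun x => exists k (p : part k 0),
    D k 0 p /\ exists2 s, finitary_perm s & x = act s (aw (ind p).1).

Definition normal_subgroup (G : groupType) (N : G -> Prop) : Prop :=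
  [/\ N 1%g,
      forall x y, N x -> N y -> N (x * y)%g,
      forall x, N x -> N (x^-1)%g
    & forall x y, N x -> N (x ^ y)%g].

Definition Sinfty_invariant (N : Z2free -> Prop) : Prop :=
  forall s x, finitary_perm s -> N x -> N (act s x).

Definition ker0 k (i : k.-tuple nat) : part k 0 := ker i [tuple].

Section LinearMaps.
Local Open Scope ring_scope.
Variables (C : numClosedFieldType) (n : nat).

(* The k-th tensor power of C^n: v i is the coefficient of
   e_(i_1) (x) ... (x) e_(i_k) in v. *)
Definition tens (k : nat) := {ffun k.-tuple 'I_n -> C^o}.
HB.instance Definition _ k := Vector.on (tens k).

Definition basis_vec k (i : k.-tuple 'I_n) : tens k :=
  [ffun i' => (i' == i)%:R].

Definition lin_ext k (V : vectType C) (phi : k.-tuple 'I_n -> V) :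
    'Hom(tens k, V) :=
  linfun (fun v : tens k => \sum_i (v i : C) *: phi i).

Lemma lin_extE k (V : vectType C) (phi : k.-tuple 'I_n -> V) (v : tens k) :
  lin_ext phi v = \sum_i (v i : C) *: phi i.
Proof.
pose f := fun v : tens k => \sum_i (v i : C) *: phi i.
have flin : linear f.
  move=> a u w; rewrite /f scaler_sumr -big_split /=; apply: eq_bigr => i _.
  by rewrite !ffunE scalerDl scalerA.
pose fL := GRing.isLinear.Build _ _ _ _ f flin.
pose g : {linear tens k -> V} := HB.pack f fL.
exact: (lfunE g v).
Qed.

Lemma lin_ext_basis k (V : vectType C) (phi : k.-tuple 'I_n -> V) i :
  lin_ext phi (basis_vec i) = phi i.
Proof.
rewrite lin_extE (bigD1 i) //= big1 ?addr0 => [|i' ne].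
  by rewrite ffunE eqxx scale1r.
by rewrite ffunE (negPf ne) scale0r.
Qed.

Lemma basis_decomp k (v : tens k) : v = \sum_i (v i : C) *: basis_vec i.
Proof.
apply/ffunP=> j; rewrite sum_ffunE (bigD1 j) //= big1 ?addr0 => [|i ne].
  by rewrite !ffunE eqxx [RHS]mulr1.
by rewrite !ffunE eq_sym (negPf ne) [LHS]mulr0.
Qed.

Definition nat_tuple k (i : k.-tuple 'I_n) : k.-tuple nat :=
  [tuple of map (@nat_of_ord n) i].

Definition delta_hat k l (p : part k l)
    (i : k.-tuple 'I_n) (j : l.-tuple 'I_n) : C :=
  (`[< in_orbit_ind p (nat_tuple i) (nat_tuple j) >])%:R.

Definition T_hat k l (p : part k l) : 'Hom(tens k, tens l) :=
  lin_ext (fun i => \sum_j delta_hat p i j *: basis_vec j).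

Definition ltup k k' (i : (k + k').-tuple 'I_n) : k.-tuple 'I_n :=
  [tuple tnth i (lshift k' x) | x < k].
Definition rtup k k' (i : (k + k').-tuple 'I_n) : k'.-tuple 'I_n :=
  [tuple tnth i (rshift k x) | x < k'].

(* tensor product of vectors, under the identification of the tensor product of
   tens k and tens k' with tens (k + k') by concatenation of indices *)
Definition tensv k k' (u : tens k) (v : tens k') : tens (k + k') :=
  [ffun i => u (ltup i) * v (rtup i)].

Definition tensf k l k' l' (T : 'Hom(tens k, tens l))
    (T' : 'Hom(tens k', tens l')) : 'Hom(tens (k + k'), tens (l + l')) :=
  lin_ext (fun i => tensv (T (basis_vec (ltup i))) (T' (basis_vec (rtup i)))).

Definition inner k (u v : tens k) : C := \sum_i (u i : C) * (v i : C)^*.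

Definition adjoint k l (T : 'Hom(tens k, tens l)) : 'Hom(tens l, tens k) :=
  lin_ext (fun j => \sum_i (T (basis_vec i) j : C)^* *: basis_vec i).

Definition zeta : 'Hom(tens 0, tens 2) :=
  lin_ext (fun _ => \sum_(i < n) basis_vec [tuple i; i]).

Lemma hom_coef k l (T : 'Hom(tens k, tens l)) (v : tens k) j :
  (T v j : C) = \sum_i (v i : C) * (T (basis_vec i) j : C).
Proof.
rewrite {1}[v]basis_decomp linear_sum sum_ffunE; apply: eq_bigr => i _.
by rewrite linearZ ffunE.
Qed.

Lemma adjointP k l (T : 'Hom(tens k, tens l)) u v :
  inner (T u) v = inner u (adjoint T v).
Proof.
rewrite /inner /=.
under eq_bigr => j _ do rewrite hom_coef mulr_suml.
rewrite exchange_big; apply: eq_bigr => i _ /=.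
rewrite lin_extE sum_ffunE rmorph_sum mulr_sumr; apply: eq_bigr => j _.
rewrite ffunE sum_ffunE (bigD1 i) //= big1 ?addr0 => [|i' ne]; last first.
  by rewrite !ffunE eq_sym (negPf ne) [LHS]mulr0.
rewrite !ffunE eqxx -[_ *: 1]/(_ * 1 : C) mulr1.
rewrite -[_ *: _ : C^o]/(_ * _ : C) rmorphM /=.
by rewrite [X in _ * (_ * X)]conjCK mulrCA mulrA mulrC mulrA.
Qed.

Lemma tensfP k l k' l' (T : 'Hom(tens k, tens l))
    (T' : 'Hom(tens k', tens l')) u v :
  tensf T T' (tensv u v) = tensv (T u) (T' v).
Proof.
apply/ffunP => j; rewrite lin_extE sum_ffunE ffunE.
rewrite (hom_coef T) (hom_coef T') mulr_suml.
under [RHS]eq_bigr => a _ do rewrite mulr_sumr.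
rewrite pair_big /=.
pose h (ab : k.-tuple 'I_n * k'.-tuple 'I_n) := [tuple of ab.1 ++ ab.2].
have hl a b : ltup (h (a, b)) = a.
  by apply: eq_from_tnth => x; rewrite tnth_mktuple tnth_lshift.
have hr a b : rtup (h (a, b)) = b.
  by apply: eq_from_tnth => x; rewrite tnth_mktuple tnth_rshift.
have hK : cancel h (fun i => (ltup i, rtup i)).
  by move=> [a b]; rewrite hl hr.
have Kh : cancel (fun i => (ltup i, rtup i)) h.
  move=> i; apply: eq_from_tnth => x; case: (split_ordP x) => y ->.
    by rewrite tnth_lshift tnth_mktuple.
  by rewrite tnth_rshift tnth_mktuple.
rewrite (reindex h) /=; last by exists (fun i => (ltup i, rtup i)) => i _.
apply: eq_bigr => -[a b] _; rewrite !ffunE hl hr /=.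
by rewrite -[_ *: _]/(_ * _ : C) mulrACA.
Qed.

Definition T_span (D : partitions_set) k l : {vspace 'Hom(tens k, tens l)} :=
  <<[seq T_hat p | p <- enum {: part k l}%type & `[< D k l p >]]>>%VS.

Definition tensor_category_with_duals
    (H : forall k l, {vspace 'Hom(tens k, tens l)}) : Prop :=
  [/\ forall k l k' l' T T', T \in H k l -> T' \in H k' l' ->
        tensf T T' \in H (k + k')%N (l + l')%N,
      forall k l m T T', T \in H k l -> T' \in H l m ->
        (T' \o T)%VF \in H k m,
      forall k l T, T \in H k l -> adjoint T \in H l k,
      \1%VF \in H 1%N 1%N
    & zeta \in H 0%N 2%N].

End LinearMaps.

(* Main.v *)
Require Import Defs.
From mathcomp Require Import all_boot all_order all_algebra.
From mathcomp Require Import complex.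
From mathcomp Require Import boolp reals.

(** Rotating all lower points to the upper row turns ker(i, j) into
ker(i ++ rev j), so a rotation-closed set D of partitions is determined by the
words w with ker(w) in D ([has_ker_word]).  The argument is to show that each
of the three conditions says the same thing about this set of words: that it is
the full preimage, under w |-> a_w, of a normal subgroup of the free product
([normal_language]).

Condition (2) says this almost literally, because F_infty D consists exactly of
the elements a_w with ker(w) in D ([F_inftyP]): invariance under the finitary
permutations comes for free, and the description of D by rotations says that w
is one of these words as soon as a_w lies in F_infty D
([generated_by_F_inftyP]).

For condition (1), read the word of ker(i, j) as the element a_i a_j^-1.  The
involution then inverts, a connected tensor product conjugates one factor by a_i
and multiplies, and a composition of ker(i, j) with ker(j, g) sends
a_i a_j^-1 and a_j a_g^-1 to their product; hence a normal subgroup gives a skew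
category ([normal_skew]).  Conversely, connected tensor products insert one word
into another at an arbitrary place ([has_word_insert]), and composing with the
partition of the word [i; i] deletes a square ([has_word_delete]).  Thus the set
of words is invariant under inserting and deleting squares, i.e. under equality
in the free product, and conjugation of w by v is the insertion of w in the
middle of a word that represents 1 ([skew_normal]).  Composition can be computed
on labels because compatible partitions admit labellings that agree on the
common row and coincide elsewhere only where they must ([compatible_kerP],
[compose_ker]).

For condition (3), the matrices of the maps T_hat p are the indicator functions
of disjoint sets of index pairs; the nonempty ones are the orbits of the
symmetric group.  So a map lies in the span iff its matrix is invariant under
permutations of the indices and vanishes at (i, j) unless ker(i, j) is in D
([T_spanP]).  A nonzero
matrix entry of a tensor product, composition or adjoint comes from nonzero
entries of the factors, so the closure of the spans reduces to the closure of
the set of words ([normal_tensor_category]).  Conversely, for n large enough all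
labels occur as indices, and the entry of the tensor product, composition or
adjoint of maps T_hat at the labels in question is a positive integer; no
cancellation happens, and the partition resulting from the operation is in D
([tensor_category_skew]). *)

Set Implicit Arguments.
Unset Strict Implicit.
Unset Printing Implicit Defensive.

(** * Labellings up to relabelling *)

Section Relabelling.
Variable T : eqType.

Definition transp (a b x : T) : T :=
  if x == a then b else if x == b then a else x.

Lemma transpK a b : involutive (transp a b).
Proof.
move=> x; rewrite /transp.
case: (eqVneq x a) => [->|xa]; first by rewrite eqxx; case: eqVneq.
case: (eqVneq x b) => [->|xb]; first by rewrite eqxx.
by rewrite (negPf xa) (negPf xb).
Qed.

(** Two labellings of a finite set that identify the same points differ by a
composition of transpositions of labels, one for each point: once s is right on
the points in r, the transposition that corrects it at x fixes the labels of
these points if x shares no label with them, and is trivial otherwise.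
The class Q is a parameter so that the lemma serves both the finitary
permutations of nat and the permutations of 'I_n. *)
Lemma relabelling (I : finType) (Q : (T -> T) -> Prop) (f f' : I -> T) :
  Q id -> (forall a b s, Q s -> Q (transp a b \o s)) ->
  (forall s, Q s -> injective s) ->
  (forall x y, (f x == f y) = (f' x == f' y)) ->
  exists2 s, Q s & forall x, f x = s (f' x).
Proof.
move=> Qid Qtr Qinj ff'.
suff [s Qs sE] : exists2 s, Q s & {in enum I, forall x, f x = s (f' x)}.
  by exists s => // x; apply: sE; rewrite mem_enum.
elim: (enum I) => [|x r [s Qs sE]]; first by exists id.
exists (transp (s (f' x)) (f x) \o s) => [|y]; first exact: Qtr.
rewrite inE /transp /= (inj_eq (Qinj _ Qs)) => /predU1P [->|yr].
  by rewrite eqxx.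
rewrite -ff'; case: eqVneq => // yx.
by rewrite -(sE y yr) (negPf yx).
Qed.

End Relabelling.

Lemma finitary_perm_id : finitary_perm id.
Proof. by split; [exists id|exists 0]. Qed.

Lemma finitary_perm_comp s t :
  finitary_perm s -> finitary_perm t -> finitary_perm (s \o t).
Proof.
move=> [sb [m sm]] [tb [m' tm]]; split; first exact: bij_comp.
exists (maxn m m') => i; rewrite geq_max => /andP [mi mi'] /=.
by rewrite tm // sm.
Qed.

Lemma finitary_perm_inv s :
  finitary_perm s -> exists2 t, finitary_perm t & cancel s t.
Proof.
move=> [[t st ts] [m sm]]; exists t => //; split; first by exists s.
by exists m => i mi; rewrite -{1}(sm i mi) st.
Qed.

Lemma finitary_perm_transp a b s :
  finitary_perm s -> finitary_perm (transp a b \o s).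
Proof.
apply: finitary_perm_comp; split; first exact: inv_bij (transpK a b).
exists (maxn a.+1 b.+1) => i; rewrite geq_max => /andP [ai bi].
by rewrite /transp (gtn_eqF ai) (gtn_eqF bi).
Qed.

Lemma finitary_perm_inj s : finitary_perm s -> injective s.
Proof. by case=> /bij_inj. Qed.

Lemma label_map (T U : Type) (s : T -> U) k l (i : k.-tuple T) (j : l.-tuple T) x :
  label [tuple of map s i] [tuple of map s j] x = s (label i j x).
Proof. by case: x => x /=; rewrite tnth_map. Qed.

Lemma label_inj (T : Type) k l (i i' : k.-tuple T) (j j' : l.-tuple T) :
  label i j =1 label i' j' -> i = i' /\ j = j'.
Proof.
by move=> e; split; apply: eq_from_tnth => x;
  [exact: (e (inl x))|exact: (e (inr x))].
Qed.

Lemma eq_kerP k l (i i' : k.-tuple nat) (j j' : l.-tuple nat) :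
  ker i j = ker i' j' <->
  forall x y, (label i j x == label i j y) = (label i' j' x == label i' j' y).
Proof.
split=> [e x y|e]; first by rewrite -!same_block_ker e.
by apply: part_ext => x y; rewrite !same_block_ker.
Qed.

Lemma ker_map s k l (i : k.-tuple nat) (j : l.-tuple nat) : injective s ->
  ker [tuple of map s i] [tuple of map s j] = ker i j.
Proof. by move=> si; apply/eq_kerP => x y; rewrite !label_map (inj_eq si). Qed.

Lemma same_orbitP k l (i i' : k.-tuple nat) (j j' : l.-tuple nat) :
  same_orbit i j i' j' <-> ker i j = ker i' j'.
Proof.
split=> [[s /finitary_perm_inj si [-> ->]]|/eq_kerP e]; first exact: ker_map.
have [s Qs sE] := relabelling finitary_perm_id finitary_perm_transp
  finitary_perm_inj e.
by exists s => //; apply: label_inj => x; rewrite label_map.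
Qed.

Lemma ker_ind k l (p : part k l) : ker (ind p).1 (ind p).2 = p.
Proof. by have [] := indP p. Qed.

Lemma in_orbit_indP k l (p : part k l) i j :
  in_orbit_ind p i j <-> ker i j = p.
Proof. by rewrite /in_orbit_ind same_orbitP ker_ind. Qed.

(** * Rotation *)

Lemma ker_lower_left k l x (i : k.-tuple nat) (j : l.-tuple nat) :
  pullback (@lower_pt k l ord0 ord0) (ker [tuple of x :: i] j)
  = ker i [tuple of x :: j].
Proof.
apply: part_ext => a b; rewrite same_block_pullback !same_block_ker.
suff E c : label [tuple of x :: i] j (lower_pt ord0 ord0 c)
  = label i [tuple of x :: j] c by rewrite !E.
case: c => c /=; first by rewrite tnthS.
by case: unliftP => [c'|] -> /=; rewrite ?tnthS ?tnth0.
Qed.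

Lemma tnth_rcons_max (T : Type) k (i : k.-tuple T) x :
  tnth [tuple of rcons i x] ord_max = x.
Proof. by rewrite (tnth_nth x) nth_rcons size_tuple ltnn eqxx. Qed.

Lemma tnth_rcons_lift (T : Type) k (i : k.-tuple T) x a :
  tnth [tuple of rcons i x] (lift ord_max a) = tnth i a.
Proof.
have aE : lift ord_max a = a :> nat by rewrite /= /bump leqNgt ltn_ord.
by rewrite !(tnth_nth x) aE /= nth_rcons size_tuple ltn_ord.
Qed.

Lemma ker_lower_right k l x (i : k.-tuple nat) (j : l.-tuple nat) :
  pullback (@lower_pt k l ord_max ord_max) (ker [tuple of rcons i x] j)
  = ker i [tuple of rcons j x].
Proof.
apply: part_ext => a b; rewrite same_block_pullback !same_block_ker.
suff E c : label [tuple of rcons i x] j (lower_pt ord_max ord_max c)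
  = label i [tuple of rcons j x] c by rewrite !E.
case: c => c /=; first by rewrite tnth_rcons_lift.
by case: unliftP => [c'|] -> /=; rewrite ?tnth_rcons_lift ?tnth_rcons_max.
Qed.

Lemma ker_raise_right k l x (i : k.-tuple nat) (j : l.-tuple nat) :
  pullback (@raise_pt k l ord_max ord_max) (ker i [tuple of rcons j x])
  = ker [tuple of rcons i x] j.
Proof.
apply: part_ext => a b; rewrite same_block_pullback !same_block_ker.
suff E c : label i [tuple of rcons j x] (raise_pt ord_max ord_max c)
  = label [tuple of rcons i x] j c by rewrite !E.
case: c => c /=; last by rewrite tnth_rcons_lift.
by case: unliftP => [c'|] -> /=; rewrite ?tnth_rcons_lift ?tnth_rcons_max.
Qed.

(** The rows are plain sequences here, so that concatenation, reversal and
induction on words do not change the type of the partition. *)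
Definition has_ker (D : partitions_set) (u v : seq nat) : Prop :=
  D _ _ (ker (in_tuple u) (in_tuple v)).

Definition has_word (D : partitions_set) (w : seq nat) : Prop :=
  has_ker D w [::].

(** The two partitions have the same type only after transport along the sizes of
the rows, hence an equality of memberships instead of partitions. *)
Lemma has_kerE D k l (i : k.-tuple nat) (j : l.-tuple nat) :
  D k l (ker i j) = has_ker D i j.
Proof.
case: i j => [u su] [v sv]; rewrite /has_ker /=.
have eu := eqP su; have ev := eqP sv; subst k l.
by rewrite (bool_irrelevance su (eqxx _)) (bool_irrelevance sv (eqxx _)).
Qed.

Section RotationClosed.
Variables (D : partitions_set) (rotD : rotation_closed D).

Lemma basic_rotationD k l (p : part k l) k' l' (q : part k' l') :
  basic_rotation p q -> D p -> D q.
Proof.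
by move=> pq Dp; apply: rotD Dp _; apply: rotation_step pq; exact: rotation_refl.
Qed.

Lemma has_ker_lower_left x u v : has_ker D (x :: u) v -> has_ker D u (x :: v).
Proof.
rewrite -(has_kerE D [tuple of x :: in_tuple u] (in_tuple v)).
rewrite -(has_kerE D (in_tuple u) [tuple of x :: in_tuple v]).
rewrite -ker_lower_left; apply: basic_rotationD; exact: rot_lower_left.
Qed.

Lemma has_ker_lower_right x u v :
  has_ker D (rcons u x) v -> has_ker D u (rcons v x).
Proof.
rewrite -(has_kerE D [tuple of rcons (in_tuple u) x] (in_tuple v)).
rewrite -(has_kerE D (in_tuple u) [tuple of rcons (in_tuple v) x]).
rewrite -ker_lower_right; apply: basic_rotationD; exact: rot_lower_right.
Qed.

Lemma has_ker_raise_right x u v :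
  has_ker D u (rcons v x) -> has_ker D (rcons u x) v.
Proof.
rewrite -(has_kerE D [tuple of rcons (in_tuple u) x] (in_tuple v)).
rewrite -(has_kerE D (in_tuple u) [tuple of rcons (in_tuple v) x]).
rewrite -ker_raise_right; apply: basic_rotationD; exact: rot_raise_right.
Qed.

(** The rightmost lower point becomes the rightmost upper point, so the lower
row arrives in reverse order. *)
Lemma has_ker_word u v : has_ker D u v <-> has_word D (u ++ rev v).
Proof.
elim/last_ind: v u => [|v x IHv] u; first by rewrite cats0.
rewrite rev_rcons -cat_rcons -IHv.
by split; [exact: has_ker_raise_right|exact: has_ker_lower_right].
Qed.

(** The leftmost upper point passes through the lower row to the right end of
the upper row. *)
Lemma has_word_cyclic u v : has_word D (u ++ v) -> has_word D (v ++ u).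
Proof.
elim: u v => [|x u IHu] v; first by rewrite cats0.
move=> /has_ker_lower_left /(has_ker_word _ [:: x]).
by rewrite -catA => /IHu; rewrite -catA.
Qed.

End RotationClosed.

Lemma has_word_ker D k (i : k.-tuple nat) : D k 0 (ker0 i) <-> has_word D i.
Proof. by rewrite /ker0 has_kerE. Qed.

Lemma rotation_trans k l (p : part k l) k1 l1 (q : part k1 l1) k2 l2
    (r : part k2 l2) : rotation p q -> rotation q r -> rotation p r.
Proof.
move=> pq; elim=> [//|k3 l3 q' k4 l4 r' _ pq' br].
exact: rotation_step pq' br.
Qed.

(** * Composition on labels *)

(** The index of a partition is in the orbit of each of its labellings, so both
indices restrict to relabellings of the common row j. *)
Lemma compatible_ker k l m (i : k.-tuple nat) (j : l.-tuple nat)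
    (g : m.-tuple nat) : compatible (ker i j) (ker j g).
Proof.
have /in_orbit_indP [s sP [_ es]] := erefl (ker i j).
have /in_orbit_indP [t tP [et _]] := erefl (ker j g).
have [s' s'P sK] := finitary_perm_inv sP.
exists (s' \o t); first exact: finitary_perm_comp.
apply: val_inj; rewrite /= map_comp.
have /(congr1 val) /= <- := et; have /(congr1 val) /= -> := es.
by rewrite mapK.
Qed.

(** This is the condition under which labels may be compared across the middle
row j: a coincidence of labels of the outer rows is witnessed there. *)
Definition glued k l m (i : k.-tuple nat) (j : l.-tuple nat)
    (g : m.-tuple nat) : Prop :=
  forall x, x \in i -> x \in g -> x \in j.

(** The index of q is first relabelled so that its upper row agrees with the
lower row of p.  Shifting the labels that do not occur in that row by a bound B
then separates the labels of the two outer rows that are not forced to agree. *)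
Lemma compatible_kerP k l m (p : part k l) (q : part l m) :
  compatible p q ->
  exists i j g, [/\ p = ker i j, q = ker j g & glued i j g].
Proof.
case=> s /finitary_perm_inj si e.
pose i := (ind p).1; pose j := (ind p).2.
pose h := [tuple of map s (ind q).2].
have qE : q = ker j h by rewrite -[LHS]ker_ind -(ker_map _ _ si) -e.
have [B Bi Bj] : exists2 B, {in i, forall x, x < B} & {in j, forall x, x < B}.
  exists (\max_(x <- i ++ j) x).+1 => x xi; rewrite ltnS;
    by apply: leq_bigmax_seq => //; rewrite mem_cat xi ?orbT.
pose t z := if z \in j then z else z + B.
have tj z : (t z \in j) = (z \in j).
  rewrite /t; case: ifP => // _; apply/negbTE/negP => /Bj.
  by rewrite ltnNge leq_addl.
have ti : injective t.
  move=> x y e'; have := tj x; rewrite e' tj; move: e'; rewrite /t => + xy.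
  by rewrite xy; case: ifP => // _ /addIn.
have tjE : j = [tuple of map t j].
  apply: val_inj => /=; rewrite -[LHS]map_id; apply/eq_in_map => z zj.
  by rewrite /t zj.
exists i, j, [tuple of map t h]; split; first by rewrite ker_ind.
  by rewrite {1}tjE ker_map.
move=> x xi /mapP [z _ xE]; move: xi; rewrite xE tj /t.
by case: ifP => // _ /Bi; rewrite ltnNge leq_addl.
Qed.

(** Neighbours in the stack carry the same label, so connected points do.
Conversely two points of one row with the same label are neighbours, and an
upper and a lower point with the same label are both neighbours of a middle
point with that label. *)
Lemma compose_ker k l m (i : k.-tuple nat) (j : l.-tuple nat)
    (g : m.-tuple nat) : glued i j g ->
  compose (ker i j) (ker j g) = ker i g.
Proof.
move=> ijg; apply: part_ext => x y; rewrite same_block_compose same_block_ker.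
pose lab z := match z with inl u => label i j u | inr c => tnth g c end.
have lab_low u : lab (stack_low k u) = label j g u by case: u.
have lab_out u : lab (stack_outer l u) = label i g u by case: u.
have upE u v : label i j u = label i j v ->
    stack (ker i j) (ker j g) (inl u) (inl v).
  move=> e; apply/orP; left; apply/existsP; exists u; apply/existsP; exists v.
  by rewrite !eqxx same_block_ker e eqxx.
have lowE u v : label j g u = label j g v ->
    stack (ker i j) (ker j g) (stack_low k u) (stack_low k v).
  move=> e; apply/orP; right; apply/existsP; exists u; apply/existsP; exists v.
  by rewrite !eqxx same_block_ker e eqxx.
rewrite -!lab_out; apply/idP/idP => [/connectP [p pth ->]|/eqP].
  elim: p (stack_outer l x) pth => [|z p IHp] w //= /andP [wz /IHp /eqP <-].
  case/orP: wz => /existsP [u /existsP [v /and3P [/eqP -> /eqP ->]]];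
    by rewrite same_block_ker ?lab_low.
rewrite /connected_in_stack.
have mid a c : tnth i a = tnth g c ->
    connect (stack (ker i j) (ker j g)) (inl (inl a)) (inr c).
  move=> e; have /tnthP [b bE] : tnth i a \in j.
    by apply: ijg; [|rewrite e]; exact: mem_tnth.
  apply: (@connect_trans _ _ (inl (inr b))); apply: connect1.
    exact: (upE (inl a) (inr b)).
  by apply: (lowE (inl b) (inr c)); rewrite /= -bE e.
have csym := sym_connect_sym (stack_sym (ker i j) (ker j g)).
case: x y => [a|c] [a'|c'] //= e.
- by apply: connect1; exact: (upE (inl a) (inl a')).
- exact: mid.
- by rewrite csym; apply: mid.
- by apply: connect1; exact: (lowE (inr c) (inr c')).
Qed.

(** * Skew categories and normal subgroups *)

Lemma cong_cancel u w v : word_cong ((u ++ rev w) ++ (w ++ v)) (u ++ v).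
Proof.
rewrite -catA; apply: cong_cat; first exact: cong_refl.
rewrite catA -[X in word_cong _ X]cat0s.
by apply: cong_cat; [exact: cong_revl|exact: cong_refl].
Qed.

Lemma cong_revr w : word_cong (w ++ rev w) [::].
Proof. by rewrite -[w in w ++ _]revK; exact: cong_revl. Qed.

(** L is the preimage of a normal subgroup of the free product under aw; as every
generator is its own inverse, rev w represents the inverse of w. *)
Definition normal_language (L : seq nat -> Prop) : Prop :=
  [/\ forall u v, word_cong u v -> L u -> L v,
      L [::],
      forall u v, L u -> L v -> L (u ++ v),
      forall w, L w -> L (rev w)
    & forall v w, L w -> L (rev v ++ w ++ v)].

(** Rotated to the upper row, the connected tensor product of ker(u, rev v) and
ker(w) has the word u ++ w ++ v. *)
Lemma has_word_insert D u w v : rotation_closed D -> skew_category D ->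
  has_word D (u ++ v) -> has_word D w -> has_word D (u ++ w ++ v).
Proof.
move=> rotD [_ _ _ Dtens _] uv w_D.
have {uv} : has_ker D u (rev v) by rewrite has_ker_word // revK.
move=> /Dtens /(_ w_D) => /(_ (ker [tuple of in_tuple u ++ in_tuple w]
  [tuple of in_tuple (rev v) ++ [tuple]])) H.
have /H : connected_tensor (ker (in_tuple u) (in_tuple (rev v)))
    (ker (in_tuple w) (in_tuple [::]))
    (ker [tuple of in_tuple u ++ in_tuple w]
      [tuple of in_tuple (rev v) ++ [tuple]]).
  exists (in_tuple u), (in_tuple (rev v)), (in_tuple w), (in_tuple [::]).
  split; [exact/in_orbit_indP|exact/in_orbit_indP|].
  by congr ker; apply: val_inj.
by rewrite has_kerE has_ker_word //= cats0 revK catA.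
Qed.

Lemma has_word_map D s w : injective s -> has_word D w ->
  has_word D (map s w).
Proof.
move=> si; rewrite /has_word -(has_kerE D (in_tuple w) [tuple]).
rewrite -(ker_map (in_tuple w) [tuple] si).
by rewrite has_kerE.
Qed.

Lemma has_word_square D i : skew_category D -> has_word D [:: i; i].
Proof.
case=> D2 _ _ _ _; move: D2; rewrite has_kerE => /(has_word_map (@addnI i)).
by rewrite /= addn0.
Qed.

Lemma has_word_compose D (u v w : seq nat) :
  rotation_closed D -> skew_category D ->
  (forall x, x \in u -> x \in w -> x \in v) ->
  has_word D (u ++ rev v) -> has_word D (v ++ rev w) -> has_word D (u ++ rev w).
Proof.
move=> rotD [_ _ _ _ Dcomp] uwv; rewrite -!has_ker_word // => uv vw.
rewrite /has_ker -(@compose_ker _ _ _ _ (in_tuple v)) //.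
by apply: Dcomp; [exact: uv|exact: vw|exact: compatible_ker].
Qed.

(** After a cyclic rotation the square stands in front, and ker([::], [i; i]) can
be composed with the partition that has [i; i] as its upper row. *)
Lemma has_word_delete D u i v : rotation_closed D -> skew_category D ->
  has_word D (u ++ [:: i; i] ++ v) -> has_word D (u ++ v).
Proof.
move=> rotD skD /has_word_cyclic; rewrite -catA => /(_ rotD) ivu.
apply: has_word_cyclic => //.
rewrite -[v ++ u]cat0s -[v ++ u]revK.
apply: (@has_word_compose _ _ [:: i; i]) => //; last by rewrite revK.
exact: has_word_square.
Qed.

(** The context x, y makes the induction go through concatenations, which are
replaced one factor at a time. *)
Lemma skew_word_cong D u v : rotation_closed D -> skew_category D ->
  word_cong u v -> forall x y, has_word D (x ++ u ++ y) <-> has_word D (x ++ v ++ y).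
Proof.
move=> rotD skD; elim=> //.
- move=> i x y; split; first exact: has_word_delete.
  move=> xy; apply: has_word_insert => //; exact: has_word_square.
- by move=> u1 v1 _ IH x y; rewrite IH.
- by move=> u1 v1 w1 _ IH1 _ IH2 x y; rewrite IH1 IH2.
- move=> u1 u2 v1 v2 _ IH1 _ IH2 x y.
  by rewrite -!catA IH1 catA IH2 -catA.
Qed.

(** The word of the involution of ker(w) is rev w, and w is conjugated by v by
inserting w into rev v ++ v, which represents 1. *)
Lemma skew_normal D : rotation_closed D -> skew_category D ->
  normal_language (has_word D).
Proof.
move=> rotD skD.
have sat u v : word_cong u v -> has_word D u -> has_word D v.
  by move=> /(skew_word_cong rotD skD) /(_ [::] [::]); rewrite !cats0 => -[].
have L0 : has_word D [::] by apply: sat (cong_rel 0) _; exact: has_word_square.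
have Lcat u v : has_word D u -> has_word D v -> has_word D (u ++ v).
  by move=> Lu Lv; rewrite -[u ++ v]cats0 -catA; apply: has_word_insert;
    rewrite ?cats0.
split=> // [w Lw|v w Lw].
  have [_ _ Dinv _ _] := skD.
  have /Dinv : D _ _ (ker (in_tuple w) (in_tuple [::])) by [].
  rewrite involution_ker -[rev w]/([::] ++ rev w) -has_ker_word //.
apply: has_word_insert => //; apply: sat L0.
by apply: cong_sym; exact: cong_revl.
Qed.

(** In each case the word of the new partition represents a product of inverses
and conjugates of the elements represented by the given words. *)
Lemma normal_skew D : rotation_closed D -> normal_language (has_word D) ->
  skew_category D.
Proof.
move=> rotD [sat L0 Lcat Lrev Lconj].
have LrevK w : has_word D (w ++ rev w).
  by apply: sat L0; apply: cong_sym; exact: cong_revr.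
split.
- by rewrite has_kerE; exact: (LrevK [:: 0]).
- by rewrite has_kerE has_ker_word //; exact: (LrevK [:: 0]).
- move=> k l p; rewrite -(ker_ind p) involution_ker !has_kerE.
  by rewrite !has_ker_word // => /Lrev; rewrite rev_cat revK.
- move=> k l p k' l' q r pD qD [i [j [f [g [/in_orbit_indP ip /in_orbit_indP fq ->]]]]].
  move: pD qD; rewrite -ip -fq !has_kerE !has_ker_word //= => ijD fgD.
  (* a_i (a_f a_g^-1) a_i^-1 times a_i a_j^-1 *)
  have := Lcat _ _ (Lconj (rev i) _ fgD) ijD; apply: sat.
  have := cong_cancel (i ++ f ++ rev g) i (rev j).
  by rewrite revK rev_cat -!catA.
move=> k l m p q pD qD /compatible_kerP [i [j [g [pE qE ijg]]]].
move: pD qD; rewrite pE qE compose_ker // !has_kerE !has_ker_word // => ijD jgD.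
have := Lcat _ _ ijD jgD; apply: sat; exact: cong_cancel.
Qed.

(** The action of the finitary permutations only changes the labels of a word,
not its kernel. *)
Lemma F_inftyP D x : F_infty D x <-> exists2 w, has_word D w & x = aw w.
Proof.
split=> [[k [p [Dp [s sP ->]]]]|[w Lw ->]].
  exists (map s (ind p).1); last by rewrite act_aw.
  apply: has_word_map; first exact: finitary_perm_inj.
  apply/has_word_ker; rewrite /ker0.
  by have -> : [tuple] = (ind p).2; [rewrite (tuple0 (ind p).2)|rewrite ker_ind].
have /in_orbit_indP [s sP [ws _]] := erefl (ker0 (in_tuple w)).
exists (size w), (ker0 (in_tuple w)); split; first exact/has_word_ker.
by exists s => //; rewrite act_aw; congr aw; exact: (congr1 val ws).
Qed.

Lemma awM u v : (aw u * aw v)%g = aw (u ++ v).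
Proof. by rewrite !aw_wcl; exact: zmulE. Qed.

Lemma awV u : ((aw u)^-1)%g = aw (rev u).
Proof. by rewrite !aw_wcl; exact: zinvE. Qed.

Lemma awP u v : aw u = aw v <-> word_cong u v.
Proof. by rewrite !aw_wcl; exact: wclP. Qed.

Lemma aw_surj x : exists w, x = aw w.
Proof. by exists (wrepr x); rewrite aw_wcl wreprK. Qed.

Lemma Sinfty_invariant_F_infty D : Sinfty_invariant (F_infty D).
Proof.
move=> s x sP /F_inftyP [w Lw ->]; rewrite act_aw; apply/F_inftyP.
by exists (map s w) => //; apply: has_word_map => //; exact: finitary_perm_inj.
Qed.

Lemma normal_languageP D :
  normal_language (has_word D) <->
  normal_subgroup (F_infty D) /\
  forall w, F_infty D (aw w) -> has_word D w.
Proof.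
split=> [[sat L0 Lcat Lrev Lconj]|[[F1 FM FV FJ] FL]].
  split; last by move=> w /F_inftyP [v Lv /awP wv]; apply: sat Lv; exact: cong_sym.
  split.
  - by apply/F_inftyP; exists [::]; rewrite // aw_wcl.
  - move=> x y /F_inftyP [u Lu ->] /F_inftyP [v Lv ->]; apply/F_inftyP.
    by exists (u ++ v); [exact: Lcat|rewrite awM].
  - move=> x /F_inftyP [u Lu ->]; apply/F_inftyP.
    by exists (rev u); [exact: Lrev|rewrite awV].
  - move=> x y /F_inftyP [u Lu ->]; have [v ->] := aw_surj y; apply/F_inftyP.
    exists (rev v ++ u ++ v); first exact: Lconj.
    by rewrite /conjg awV !awM.
have LF w : has_word D w <-> F_infty D (aw w).
  by split=> [Lw|]; [apply/F_inftyP; exists w|exact: FL].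
split=> [u v /awP uv|||w|v w]; rewrite ?LF.
- by rewrite uv.
- by move: F1; rewrite -[1%g]/zone /zone -aw_wcl.
- by move=> u v; rewrite !LF -awM; exact: FM.
- by rewrite -awV; exact: FV.
- by move=> /(FJ _ (aw v)); rewrite /conjg awV !awM.
Qed.

(** The set of rotations of a fixed partition is rotation-closed, so the
equivalence between ker(i, j) and its word applies to it. *)
Lemma rotation_ker k l (i : k.-tuple nat) (j : l.-tuple nat) :
  rotation (ker0 [tuple of i ++ [tuple of rev j]]) (ker i j).
Proof.
set p := ker0 _; pose D : partitions_set := fun _ _ q => rotation p q.
have rotD : rotation_closed D.
  by move=> k1 l1 q k2 l2 r; exact: rotation_trans.
have Dp : D _ _ p by exact: rotation_refl.
suff : D _ _ (ker i j) by [].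
by rewrite has_kerE has_ker_word //; move: Dp; rewrite /p /ker0 has_kerE.
Qed.

(** Every member of D is a rotation of its own word, so the inclusion of D in the
set of these rotations always holds, and only saturation remains. *)
Lemma generated_by_F_inftyP D : rotation_closed D ->
  (forall k l (p : part k l), D k l p <->
      exists m (i : m.-tuple nat), F_infty D (aw i) /\ rotation (ker0 i) p)
  <-> forall w, F_infty D (aw w) -> has_word D w.
Proof.
move=> rotD; split=> [DF w Fw|FL k l p].
  apply/(has_word_ker D (in_tuple w))/DF; exists (size w), (in_tuple w).
  by split=> //; exact: rotation_refl.
split=> [|[m [i [/FL Li ip]]]]; last by apply: rotD ip; apply/has_word_ker.
rewrite -{1}(ker_ind p) has_kerE has_ker_word // => Lp.
exists _, [tuple of (ind p).1 ++ [tuple of rev (ind p).2]]; split.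
  by apply/F_inftyP; exists ((ind p).1 ++ rev (ind p).2).
by have := rotation_ker (ind p).1 (ind p).2; rewrite ker_ind.
Qed.

(** * The spans of the maps T_hat *)

Section SpanDescription.
Local Open Scope ring_scope.
Import GRing.Theory Num.Theory.
Variables (C : numClosedFieldType) (n : nat).

Definition coef k l (T : 'Hom(tens C n k, tens C n l)) i j : C :=
  T (basis_vec C i) j.

Lemma hom_ext k l (T T' : 'Hom(tens C n k, tens C n l)) :
  coef T =2 coef T' -> T = T'.
Proof.
move=> e; apply/lfunP => v; apply/ffunP => j.
have := hom_coef T v j; have := hom_coef T' v j => -> ->.
by apply: eq_bigr => i _; congr (_ * _); exact: e.
Qed.

Lemma coef_lin_ext k l (phi : k.-tuple 'I_n -> tens C n l) i j :
  coef (lin_ext phi) i j = phi i j.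
Proof. by rewrite /coef lin_ext_basis. Qed.

Lemma coef_sum k l (I : Type) (r : seq I) (P : pred I) (c : I -> C)
    (F : I -> 'Hom(tens C n k, tens C n l)) i j :
  coef (\sum_(x <- r | P x) c x *: F x) i j
  = \sum_(x <- r | P x) c x * coef (F x) i j.
Proof.
rewrite /coef sum_lfunE sum_ffunE; apply: eq_bigr => x _.
by rewrite scale_lfunE ffunE.
Qed.

Lemma sum_basis l (c : l.-tuple 'I_n -> C) j :
  (\sum_j' c j' *: basis_vec C j') j = c j.
Proof.
rewrite sum_ffunE (bigD1 j) //= big1 => [|j' jj']; last first.
  by rewrite !ffunE eq_sym (negPf jj') [LHS]mulr0.
by rewrite addr0 !ffunE eqxx [LHS]mulr1.
Qed.

Lemma coef_T_hat k l (p : part k l) i j :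
  coef (T_hat C n p) i j = (ker (nat_tuple i) (nat_tuple j) == p)%:R.
Proof.
rewrite /T_hat coef_lin_ext sum_basis /delta_hat; congr (nat_of_bool _)%:R.
by apply/asboolP/eqP => /in_orbit_indP.
Qed.

Lemma coef_tensf k l k' l' (T : 'Hom(tens C n k, tens C n l))
    (T' : 'Hom(tens C n k', tens C n l')) i j :
  coef (tensf T T') i j = coef T (ltup i) (ltup j) * coef T' (rtup i) (rtup j).
Proof. by rewrite /tensf coef_lin_ext ffunE. Qed.

Lemma coef_comp k l m (T : 'Hom(tens C n k, tens C n l))
    (T' : 'Hom(tens C n l, tens C n m)) i g :
  coef (T' \o T)%VF i g = \sum_j coef T i j * coef T' j g.
Proof. by rewrite /coef comp_lfunE hom_coef. Qed.

Lemma coef_adjoint k l (T : 'Hom(tens C n k, tens C n l)) i j :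
  coef (adjoint T) j i = (coef T i j)^*.
Proof. by rewrite /adjoint coef_lin_ext sum_basis. Qed.

Lemma coef_id k i j : coef (\1%VF : 'Hom(tens C n k, tens C n k)) i j = (j == i)%:R.
Proof. by rewrite /coef id_lfunE ffunE. Qed.

Lemma coef_zeta i j :
  coef (zeta C n) i j = (j == [tuple tnth j ord0; tnth j ord0])%:R.
Proof.
rewrite /zeta coef_lin_ext sum_ffunE (bigD1 (tnth j ord0)) //= big1 => [|a ja].
  by rewrite addr0 ffunE.
rewrite ffunE; case: eqVneq => // e; case/eqP: ja.
by rewrite e; apply: val_inj.
Qed.

Definition equivariant k l (T : 'Hom(tens C n k, tens C n l)) : Prop :=
  forall s : 'I_n -> 'I_n, injective s ->
  forall (i : k.-tuple 'I_n) (j : l.-tuple 'I_n),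
    coef T [tuple of map s i] [tuple of map s j] = coef T i j.

Definition supported_on (D : partitions_set) k l
    (T : 'Hom(tens C n k, tens C n l)) : Prop :=
  forall i j, coef T i j != 0 -> D k l (ker (nat_tuple i) (nat_tuple j)).

Lemma eq_ker_nat_tuple k l (i i' : k.-tuple 'I_n) (j j' : l.-tuple 'I_n) :
  ker (nat_tuple i) (nat_tuple j) = ker (nat_tuple i') (nat_tuple j') <->
  exists2 s : 'I_n -> 'I_n, injective s &
    i = [tuple of map s i'] /\ j = [tuple of map s j'].
Proof.
have ordE (i1 : k.-tuple 'I_n) (j1 : l.-tuple 'I_n) x y :
    (label (nat_tuple i1) (nat_tuple j1) x
      == label (nat_tuple i1) (nat_tuple j1) y)
    = (label i1 j1 x == label i1 j1 y).
  by rewrite !label_map.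
rewrite eq_kerP; split=> [e|[s si [-> ->]] x y]; last first.
  by rewrite !ordE !label_map (inj_eq si).
have [//||//|x y|s si sE] :=
  @relabelling _ _ (fun s => injective s) (label i j) (label i' j').
- by move=> a b s si; apply: inj_comp si; exact: inv_inj (transpK a b).
- by rewrite -!ordE e.
by exists s => //; apply: label_inj => x; rewrite label_map.
Qed.

(** For the converse direction, an equivariant T is constant on the set of index
pairs with kernel p, so it is the combination of the T_hat p whose coefficient
is the entry of T at any such pair.  For small n there may be no such pair; then
T_hat p = 0 and the coefficient does not matter. *)
Lemma T_spanP D k l (T : 'Hom(tens C n k, tens C n l)) :
  T \in T_span C n D k l <-> equivariant T /\ supported_on D T.
Proof.
set X := [seq T_hat C n p | p <- enum {: part k l}%type & `[< D k l p >]].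
split=> [TX|[Teq TD]].
  have TE i j : coef T i j
      = \sum_(m < size X) coord (in_tuple X) m T * coef X`_m i j.
    by rewrite {1}(coord_span (X := in_tuple X) TX) coef_sum.
  have XE (m : 'I_(size X)) : exists2 p, D k l p & X`_m = T_hat C n p.
    have /mapP [p] : X`_m \in X by exact: mem_nth.
    by rewrite mem_filter => /andP [/asboolP Dp _]; exists p.
  split=> [s si i j|i j].
    rewrite !TE; apply: eq_bigr => m _; have [p _ ->] := XE m.
    rewrite !coef_T_hat; congr (_ * (_ == _)%:R).
    by apply/eq_ker_nat_tuple; exists s.
  rewrite TE => nz; apply: contrapT => nD; case/eqP: nz.
  apply: big1 => m _; have [p Dp ->] := XE m.
  rewrite coef_T_hat; case: eqVneq => [e|]; last by rewrite mulr0.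
  by rewrite e in nD.
pose c (p : part k l) : C :=
  if [pick ij | ker (nat_tuple ij.1) (nat_tuple ij.2) == p] is Some ij
  then coef T ij.1 ij.2 else 0.
have -> : T = \sum_(p <- enum {: part k l}%type | `[< D k l p >])
    c p *: T_hat C n p.
  apply: hom_ext => i j; rewrite coef_sum.
  pose p := ker (nat_tuple i) (nat_tuple j).
  have cp : coef T i j = c p.
    rewrite /c; case: pickP => [[i' j'] /= /eqP/esym/eq_ker_nat_tuple|/(_ (i, j))].
      by move=> [s si [-> ->]]; exact: Teq.
    by rewrite eqxx.
  rewrite big_enum_cond /=.
  under eq_bigr => q _ do rewrite coef_T_hat -/p.
  have [Dp|nDp] := pselect (D k l p).
    rewrite (bigD1 p) /=; last exact/asboolP.
    rewrite eqxx mulr1 -cp big1 ?addr0 // => q /andP [_ /negPf].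
    by rewrite eq_sym => ->; rewrite mulr0.
  rewrite big1 => [|q /asboolP Dq].
    by apply/eqP; apply/negPn/negP => /TD.
  by case: eqVneq => [e|]; [rewrite e in nDp|rewrite mulr0].
apply: memv_suml => q Dq; apply/memvZ/memv_span/map_f.
by rewrite mem_filter Dq mem_enum.
Qed.

Lemma ltup_map k k' (s : 'I_n -> 'I_n) (i : (k + k').-tuple 'I_n) :
  ltup [tuple of map s i] = [tuple of map s (ltup i)].
Proof. by apply: eq_from_tnth => x; rewrite !(tnth_mktuple, tnth_map). Qed.

Lemma rtup_map k k' (s : 'I_n -> 'I_n) (i : (k + k').-tuple 'I_n) :
  rtup [tuple of map s i] = [tuple of map s (rtup i)].
Proof. by apply: eq_from_tnth => x; rewrite !(tnth_mktuple, tnth_map). Qed.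

Lemma ltup_cat k k' (i : k.-tuple 'I_n) (f : k'.-tuple 'I_n) :
  ltup [tuple of i ++ f] = i.
Proof. by apply: eq_from_tnth => x; rewrite tnth_mktuple tnth_lshift. Qed.

Lemma rtup_cat k k' (i : k.-tuple 'I_n) (f : k'.-tuple 'I_n) :
  rtup [tuple of i ++ f] = f.
Proof. by apply: eq_from_tnth => x; rewrite tnth_mktuple tnth_rshift. Qed.

Lemma cat_ltup_rtup k k' (i : (k + k').-tuple 'I_n) :
  [tuple of ltup i ++ rtup i] = i.
Proof.
apply: eq_from_tnth => x; case: (split_ordP x) => y ->.
  by rewrite tnth_lshift tnth_mktuple.
by rewrite tnth_rshift tnth_mktuple.
Qed.

Lemma map_tuple_inj (s : 'I_n -> 'I_n) m : injective s ->
  injective (fun i : m.-tuple 'I_n => [tuple of map s i]).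
Proof.
by move=> si i i' /(congr1 val) /= /(inj_map si) ii'; exact: val_inj.
Qed.

(** Equivariance of a composition is a reindexing of the sum over the middle
index.  For its support, a nonzero term of that sum has the same labels j in both
factors, so that the two words multiply. *)
Lemma normal_tensor_category D : rotation_closed D ->
  normal_language (has_word D) -> tensor_category_with_duals (T_span C n D).
Proof.
move=> rotD LD; have [sat L0 Lcat Lrev _] := LD.
have [_ _ Dinv Dtens _] := normal_skew rotD LD.
have LrevK w : has_word D (w ++ rev w).
  by apply: sat L0; apply: cong_sym; exact: cong_revr.
split.
- move=> k l k' l' T T' /T_spanP [Te TD] /T_spanP [Te' TD'].
  apply/T_spanP; split=> [s si i j|i j].
    by rewrite !coef_tensf !ltup_map !rtup_map Te // Te'.
  rewrite coef_tensf mulf_eq0 negb_or => /andP [/TD ijD /TD' fgD].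
  apply: Dtens ijD fgD _.
  exists (nat_tuple (ltup i)), (nat_tuple (ltup j)).
  exists (nat_tuple (rtup i)), (nat_tuple (rtup j)).
  split; [exact/in_orbit_indP|exact/in_orbit_indP|].
  by congr ker; apply: val_inj; rewrite /= -map_cat;
    [rewrite -{1}(cat_ltup_rtup i)|rewrite -{1}(cat_ltup_rtup j)].
- move=> k l m T T' /T_spanP [Te TD] /T_spanP [Te' TD'].
  apply/T_spanP; split=> [s si i g|i g].
    rewrite !coef_comp (reindex_inj (map_tuple_inj (m := l) si)).
    by apply: eq_bigr => j _; rewrite Te // Te'.
  rewrite coef_comp => nz.
  have [j] : exists j, coef T i j * coef T' j g != 0.
    apply: contrapT => no; case/eqP: nz; apply: big1 => j _.
    by apply/eqP/negPn/negP => jnz; case: no; exists j.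
  rewrite mulf_eq0 negb_or => /andP [/TD + /TD'].
  rewrite !has_kerE !has_ker_word // => ijD jgD.
  have := Lcat _ _ ijD jgD; apply: sat; exact: cong_cancel.
- move=> k l T /T_spanP [Te TD]; apply/T_spanP; split=> [s si j i|j i].
    by rewrite !coef_adjoint Te.
  by rewrite coef_adjoint conjC_eq0 -involution_ker => /TD /Dinv.
- apply/T_spanP; split=> [s si i j|i j].
    by rewrite !coef_id -(inj_eq (map_tuple_inj (m := 1) si) j i).
  rewrite coef_id; case: (eqVneq j i) => [-> _|_]; last by rewrite eqxx.
  by rewrite has_kerE has_ker_word.
apply/T_spanP; split=> [s si i j|i j].
  rewrite !coef_zeta tnth_map -(inj_eq (map_tuple_inj (m := 2) si) j).
  by congr (_ == _)%:R; apply: val_inj.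
rewrite coef_zeta; case: (eqVneq j) => [-> _|_]; last by rewrite eqxx.
rewrite (tuple0 i) has_kerE has_ker_word //.
exact: (LrevK [:: nat_of_ord _]).
Qed.

End SpanDescription.

(** * Large dimensions *)

Lemma nat_tuple_lift (w : seq nat) k (i : k.-tuple nat) : {subset i <= w} ->
  exists i' : k.-tuple 'I_(\max_(x <- w) x).+1, nat_tuple i' = i.
Proof.
move=> iw; exists [tuple of map inord i]; apply: val_inj => /=.
rewrite -map_comp -[RHS]map_id; apply/eq_in_map => x xi /=.
by rewrite inordK // ltnS; apply: leq_bigmax_seq => //; exact: iw.
Qed.

Section LargeDimension.
Local Open Scope ring_scope.
Import Order.POrderTheory GRing.Theory Num.Theory.
Variable C : numClosedFieldType.

(** Each dimension n is taken so large that all labels in sight are indices. *)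
Lemma tensor_category_skew D : rotation_closed D ->
  (forall n, (0 < n)%N -> tensor_category_with_duals (T_span C n D)) ->
  skew_category D.
Proof.
move=> rotD DT.
have TpD n k l (p : part k l) : D k l p -> T_hat C n p \in T_span C n D k l.
  move=> Dp; apply/memv_span/map_f; rewrite mem_filter mem_enum andbT.
  exact/asboolP.
split.
- have [_ _ _ _ /T_spanP [_ /(_ [tuple] [tuple ord0; ord0])]] := DT 1%N isT.
  rewrite coef_zeta eqxx oner_neq0 => /(_ isT).
  by rewrite !has_kerE has_ker_word.
- have [_ _ _ /T_spanP [_ /(_ [tuple ord0] [tuple ord0]) idD] _] := DT 1%N isT.
  by move: idD; rewrite coef_id eqxx oner_neq0 !has_kerE => /(_ isT).
- move=> k l p Dp; set i := (ind p).1; set j := (ind p).2.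
  pose w := i ++ j.
  have [|i' iE] := @nat_tuple_lift w _ i.
    by move=> x xi; rewrite !mem_cat xi ?orbT.
  have [|j' jE] := @nat_tuple_lift w _ j.
    by move=> x xj; rewrite !mem_cat xj ?orbT.
  have [_ _ Tadj _ _] := DT _ (ltn0Sn (\max_(x <- w) x)%N).
  have /T_spanP [_ /(_ j' i')] := Tadj _ _ _ (TpD _ _ _ _ Dp).
  rewrite coef_adjoint coef_T_hat iE jE ker_ind eqxx conjC_eq0 oner_neq0.
  by rewrite -involution_ker ker_ind => /(_ isT).
- move=> k l p k' l' q r Dp Dq [i [j [f [g []]]]].
  move=> /in_orbit_indP ijp /in_orbit_indP fgq ->.
  pose w := i ++ j ++ f ++ g.
  have [|i' iE] := @nat_tuple_lift w _ i.
    by move=> x xi; rewrite !mem_cat xi ?orbT.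
  have [|j' jE] := @nat_tuple_lift w _ j.
    by move=> x xj; rewrite !mem_cat xj ?orbT.
  have [|f' fE] := @nat_tuple_lift w _ f.
    by move=> x xf; rewrite !mem_cat xf ?orbT.
  have [|g' gE] := @nat_tuple_lift w _ g.
    by move=> x xg; rewrite !mem_cat xg ?orbT.
  have [Ttens _ _ _ _] := DT _ (ltn0Sn (\max_(x <- w) x)%N).
  have /T_spanP [_ /(_ [tuple of i' ++ f'] [tuple of j' ++ g'])] :=
    Ttens _ _ _ _ _ _ (TpD _ _ _ _ Dp) (TpD _ _ _ _ Dq).
  rewrite coef_tensf !ltup_cat !rtup_cat !coef_T_hat iE jE fE gE ijp fgq.
  rewrite !eqxx mulr1 oner_neq0 => /(_ isT).
  congr (D _ _ (ker _ _)); apply: val_inj;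
    by rewrite /= map_cat -?iE -?jE -?fE -?gE.
move=> k l m p q Dp Dq /compatible_kerP [i [j [g [pE qE ijg]]]].
rewrite pE qE compose_ker //.
pose w := i ++ j ++ g.
have [|i' iE] := @nat_tuple_lift w _ i.
  by move=> x xi; rewrite !mem_cat xi ?orbT.
have [|j' jE] := @nat_tuple_lift w _ j.
  by move=> x xj; rewrite !mem_cat xj ?orbT.
have [|g' gE] := @nat_tuple_lift w _ g.
  by move=> x xg; rewrite !mem_cat xg ?orbT.
have [_ Tcomp _ _ _] := DT _ (ltn0Sn (\max_(x <- w) x)%N).
have /T_spanP [_ /(_ i' g')] :=
  Tcomp _ _ _ _ _ (TpD _ _ _ _ Dp) (TpD _ _ _ _ Dq).
rewrite coef_comp iE gE; apply.
rewrite (bigD1 j') //= !coef_T_hat iE jE gE -pE -qE !eqxx mulr1.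
(* the term of j' is 1 and the others are nonnegative *)
rewrite gt_eqF // ltr_wpDr ?ltr01 //; apply: sumr_ge0 => j1 _.
by rewrite !coef_T_hat mulr_ge0 ?ler0n.
Qed.

End LargeDimension.

Theorem theorem1 (R : realType) (D : partitions_set)
    (rotD : rotation_closed D) :
  (skew_category D
   <->
   (normal_subgroup (F_infty D) /\ Sinfty_invariant (F_infty D)) /\
   (forall k l (p : part k l),
      D k l p <->
      exists m (i : m.-tuple nat), F_infty D (aw i) /\ rotation (ker0 i) p))
  /\
  (skew_category D
   <->
   forall n : nat, (0 < n)%N ->
     tensor_category_with_duals (T_span R[i]%C n D)).
Proof.
have skew_normalP : skew_category D <-> normal_language (has_word D).
  by split; [exact: skew_normal|exact: normal_skew].
split.
  rewrite skew_normalP normal_languageP generated_by_F_inftyP //.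
  by have := @Sinfty_invariant_F_infty D; tauto.
split=> [/skew_normalP LD n _|]; first exact: normal_tensor_category.
exact: tensor_category_skew.
Qed.
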